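(* Let $S$ and $S'$ be triangulated connected closed surfaces without boundary, with vertex sets $V,V'$ and triangle sets $T,T'$. Let $f\colon T\to T'$ be a bijection such that $|t_1\cap t_2|=|f(t_1)\cap f(t_2)|$ for all $t_1,t_2\in T$, and suppose that there is no simplicial map $g\colon V\to V'$ inducing $f$ (i.e. with $g(t)=f(t)$ for every $t\in T$). Then either $S$ and $S'$ are both isomorphic to the half-icosahedron $\mathcal{I}/2$, or $S$ and $S'$ are both isomorphic to the triangulated half-cube $\mathcal{TC}/2$.
   Context: Triangles are identified with their $3$-element vertex sets and $|t_1\cap t_2|$ is the number of common vertices. The half-icosahedron $\mathcal{I}/2$ is the $6$-vertex triangulation of the projective plane (quotient of the icosahedron by the antipodal map): vertices $x,a_0,\dots,a_4$, triangles $\{a_i,a_{i+1},x\}$ and $\{a_i,a_{i+1},a_{i+3}\}$ for $i=0,\dots,4$, indices mod $5$. The triangulated half-cube $\mathcal{TC}/2$ is the triangulation of the projective plane obtained from the half-cube (quotient of the cube by the antipodal map, having $3$ square faces) by subdividing each square into four triangles with an added central vertex; explicitly, vertices $x,a_0,\dots,a_5$ and the $12$ triangles $\{a_i,a_{i+1},x\}$ ($i=0,\dots,5$, indices mod $6$), $\{a_0,a_1,a_4\}$, $\{a_1,a_2,a_4\}$, $\{a_2,a_3,a_0\}$, $\{a_3,a_4,a_0\}$, $\{a_4,a_5,a_2\}$, $\{a_0,a_5,a_2\}$. *)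

(* Defs.v *)
From mathcomp Require Import all_boot all_order all_algebra.
Set Implicit Arguments.
Unset Strict Implicit.
Unset Printing Implicit Defensive.
Import GRing.Theory.
Local Open Scope ring_scope.

(* A pure two-dimensional simplicial complex on a finite vertex type V is
   represented by its set T : {set {set V}} of triangles. *)

Definition is_simplex (V : finType) (T : {set {set V}}) (A : {set V}) : bool :=
  (A != set0) && [exists t in T, A \subset t].

Definition link_edges (V : finType) (T : {set {set V}}) (v : V) :
    {set {set V}} :=
  [set t :\ v | t in T & v \in t].

(* [next s] is the cyclic successor in s, so these are the edges of the simple
   cycle visiting s in order. *)
Definition is_cycle_graph (V : finType) (E : {set {set V}}) : Prop :=
  exists s : seq V,
    [/\ uniq s, (2 < size s)%N & E = [set [set y; next s y] | y in s]].

Definition adjacent (V : finType) (T : {set {set V}}) : rel V :=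
  [rel x y | is_simplex T [set x; y]].

(* V is finite because the surface is compact.  The links being cycles says
   that there is no boundary; it also forces every element of V to lie on a
   triangle, so that V is exactly the vertex set of the complex. *)
Definition triangulated_closed_surface (V : finType) (T : {set {set V}}) :
    Prop :=
  (forall t : {set V}, t \in T -> #|t| = 3%N) /\
  (forall v : V, is_cycle_graph (link_edges T v)).

Definition connected_complex (V : finType) (T : {set {set V}}) : Prop :=
  (0 < #|V|)%N /\ (forall x y : V, connect (adjacent T) x y).

Definition simplicial_map (V V' : finType) (T : {set {set V}})
    (T' : {set {set V'}}) (g : V -> V') : Prop :=
  forall A : {set V}, is_simplex T A -> is_simplex T' (g @: A).

Definition isomorphic (V V' : finType) (T : {set {set V}})
    (T' : {set {set V'}}) : Prop :=
  exists g : V -> V', bijective g /\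
    (forall A : {set V}, is_simplex T' (g @: A) = is_simplex T A).

(* In the two models below, None is the vertex x and Some i is a_i. *)

Definition half_icosahedron : {set {set option 'Z_5}} :=
  [set [set Some i; Some (i + 1); None] | i : 'Z_5] :|:
  [set [set Some i; Some (i + 1); Some (i + 3)] | i : 'Z_5].

Definition tri6 (i j k : 'Z_6) : {set option 'Z_6} :=
  [set Some i; Some j; Some k].

Definition triangulated_half_cube : {set {set option 'Z_6}} :=
  [set [set Some i; Some (i + 1); None] | i : 'Z_6] :|:
  [set tri6 0 1 4; tri6 1 2 4; tri6 2 3 0; tri6 3 4 0; tri6 4 5 2; tri6 0 5 2].

(* Main.v *)
(* For a triangle t and a vertex v of t, let s be the neighbour of t opposite v.
   Since f preserves intersection sizes, f(t) \ f(s) is a single vertex, the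
   transfer of v at t.  If neighbouring triangles always transfer their common
   vertices in the same way, then going around vertex links gives a vertex map
   inducing f.  Otherwise some edge is flipped: its two end points are exchanged
   between the transfers at its two triangles.  A flip is so restrictive that
   adding, one at a time, the missing triangle over an edge of S together with
   its image leaves finitely many configurations; exhausting them ends in exactly
   two closed ones, the two models. *)

Require Import Defs.
From mathcomp Require Import all_boot all_order all_algebra.

Set Implicit Arguments.
Unset Strict Implicit.
Unset Printing Implicit Defensive.

(** * Edges and vertex links *)

(** The orbit of [z] under [next s] has [size s] elements, at least three, so its first three
    iterates are distinct. *)
Lemma next_next_neq (V : finType) (s : seq V) (z : V) :
  uniq s -> 2 < size s -> z \in s ->
  (next s z != z) && (next s (next s z) != z).
Proof.
move=> us ss zs.
have ord i : i < 3 -> findex (next s) z (iter i (next s) z) = i.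
  by move=> i3; rewrite findex_iter // (order_cycle (cycle_next us)) // (leq_trans i3).
by apply/andP; split; apply/eqP => E; [have := ord 1 isT | have := ord 2 isT];
  rewrite /= E (ord 0 isT).
Qed.

Lemma next_eq_prev (V : eqType) (s : seq V) (z w : V) :
  uniq s -> next s z = w -> z = prev s w.
Proof. by move=> us <-; rewrite prev_next. Qed.

Lemma card_inter_lt (V : finType) (t r : {set V}) (k : nat) :
  #|t| = k -> #|r| = k -> t != r -> #|t :&: r| < k.
Proof.
move=> ct cr ntr; rewrite ltn_neqAle -{2}ct subset_leq_card ?subsetIl ?andbT //.
apply: contra ntr => /eqP cI.
have /eqP tI : t :&: r == t by rewrite eqEcard subsetIl cI ct /=.
by rewrite eqEcard ct cr leqnn andbT -tI subsetIr.
Qed.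

Lemma card_inter_edge (V : finType) (t r e : {set V}) :
  #|t| = 3 -> #|r| = 3 -> t != r -> e \subset t -> e \subset r -> #|e| = 2 ->
  #|t :&: r| = 2.
Proof.
move=> ct cr ntr et er ce; apply/eqP; rewrite eqn_leq -ltnS.
by rewrite (card_inter_lt ct cr ntr) -ce subset_leq_card // subsetI et.
Qed.

(** Adding [v] back to the edges of its link gives a form of the cycle condition that speaks of
    triangles only. *)
Lemma link_cycle (V : finType) (T : {set {set V}}) (v : V) :
  triangulated_closed_surface T ->
  exists s : seq V, [/\ uniq s, 2 < size s,
    forall z, z \in s -> v |: [set z; next s z] \in T /\
                         v \notin [set z; next s z] &
    forall t, t \in T -> v \in t ->
      exists2 z, z \in s & t = v |: [set z; next s z]].
Proof.
case=> _ /(_ v) [s [us ss Es]]; exists s; split=> // [z zs|t tT vt].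
  have : [set z; next s z] \in link_edges T v by rewrite Es; apply: imset_f.
  case/imsetP=> t; rewrite inE => /andP[tT vt] ->.
  by rewrite setD1K // !inE eqxx.
have : t :\ v \in link_edges T v by apply: imset_f; rewrite inE tT.
by rewrite Es => /imsetP[z zs tE]; exists z => //; rewrite -tE setD1K.
Qed.

Lemma vertex_in_triangle (V : finType) (T : {set {set V}}) (v : V) :
  triangulated_closed_surface T -> exists2 t, t \in T & v \in t.
Proof.
move=> hS; have [[|z s] [_ // _ sT _]] := link_cycle v hS.
have [zT _] := sT z (mem_head z s).
by exists (v |: [set z; next (z :: s) z]); rewrite ?setU11.
Qed.

(** If the two edges agreed with their ends swapped, two steps along the cycle would return to [z],
    against length at least three. *)
Lemma link_edge_inj (V : finType) (s : seq V) (v z z' : V) :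
  uniq s -> 2 < size s -> z \in s -> z' \in s ->
  v \notin [set z; next s z] -> v \notin [set z'; next s z'] ->
  v |: [set z; next s z] = v |: [set z'; next s z'] -> z = z'.
Proof.
move=> us ss zs zs' nv nv' E.
have {}E : [set z; next s z] = [set z'; next s z'].
  by rewrite -(setU1K nv) E setU1K.
have : z \in [set z'; next s z'] by rewrite -E !inE eqxx.
have : z' \in [set z; next s z] by rewrite E !inE eqxx.
rewrite !inE => /orP[/eqP-> //|/eqP zz'] /orP[/eqP-> //|/eqP z'z].
have := next_next_neq us ss zs.
by rewrite -zz' -z'z eqxx andbF.
Qed.

(** For [e] with ends [v] and [w], the triangles over [e] correspond to the edges at [w] in the link
    of [v]. There are exactly two, towards the successor and the predecessor of [w]. *)
Lemma two_triangles_at_edge (V : finType) (T : {set {set V}}) (t e : {set V}) :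
  triangulated_closed_surface T -> t \in T -> e \subset t -> #|e| = 2 ->
  exists s, [/\ s \in T, s != t, e \subset s &
    forall r, r \in T -> e \subset r -> (r == t) || (r == s)].
Proof.
move=> hS tT et /eqP/cards2P[v [w [/negbTE nvw eE]]].
have [s [us ss sT Ts]] := link_cycle v hS.
have subE (r : {set V}) : (e \subset r) = (v \in r) && (w \in r).
  by rewrite eE subUset !sub1set.
have Es r : r \in T -> e \subset r ->
    w \in s /\ (r = v |: [set w; next s w] \/
    r = v |: [set prev s w; next s (prev s w)]).
  move=> rT; rewrite subE => /andP[vr wr].
  have [z zs rE] := Ts _ rT vr.
  move: wr; rewrite rE !inE eq_sym nvw /= => /orP[]/eqP wz.
    by rewrite wz; split => //; left.
  have zw := next_eq_prev us (esym wz).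
  by split; [rewrite wz mem_next | right; rewrite -zw].
have [ws tE] := Es _ tT et.
have ps : prev s w \in s by rewrite mem_prev.
have wp : next s (prev s w) = w by rewrite next_prev.
have [w1T w1] := sT _ ws; have [p1T p1] := sT _ ps.
have neq : v |: [set w; next s w] != v |: [set prev s w; next s (prev s w)].
  apply/eqP => /(link_edge_inj us ss ws ps w1 p1) wE.
  by have := next_next_neq us ss ws; rewrite {1}wE wp eqxx.
have in1 : e \subset v |: [set w; next s w] by rewrite subE !inE !eqxx orbT.
have in2 : e \subset v |: [set prev s w; next s (prev s w)].
  by rewrite subE !inE wp !eqxx !orbT.
case: tE => tE; [exists (v |: [set prev s w; next s (prev s w)]) |
                 exists (v |: [set w; next s w])];
  split=> //; rewrite ?tE // 1?eq_sym //.
  by move=> r rT er; have [_ [->|->]] := Es r rT er; rewrite eqxx ?orbT.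
by move=> r rT er; have [_ [->|->]] := Es r rT er; rewrite eqxx ?orbT.
Qed.

(** Walking around the link of [v] passes between triangles sharing an edge at [v], and reaches
    every triangle at [v]. *)
Lemma link_connected (V : finType) (T : {set {set V}}) (v : V)
    (P : pred {set V}) (t0 : {set V}) :
  triangulated_closed_surface T ->
  (forall t r, t \in T -> r \in T -> v \in t -> v \in r ->
     #|t :&: r| = 2 -> P t -> P r) ->
  t0 \in T -> v \in t0 -> P t0 -> forall t, t \in T -> v \in t -> P t.
Proof.
move=> hS hP t0T vt0 Pt0 t tT vt.
have [s [us ss sT Ts]] := link_cycle v hS.
have [z0 z0s t0E] := Ts _ t0T vt0; have [z zs tE] := Ts _ tT vt.
have : fconnect (next s) z0 z by rewrite (fconnect_cycle (cycle_next us)).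
rewrite {}tE {t tT vt} => /iter_findex <-; elim: (findex _ _ _) => [|k IH].
  by rewrite /= -t0E.
rewrite iterS; set y := iter k _ _ in IH *.
have ys : y \in s by rewrite /y; elim: (k) => [|j]; rewrite // iterS mem_next.
have nys : next s y \in s by rewrite mem_next.
have [yT vy] := sT _ ys; have [nyT vny] := sT _ nys.
apply: hP IH; rewrite // ?inE ?eqxx //.
have nvy : v != next s y by apply: contraNneq vy => ->; rewrite !inE eqxx orbT.
apply: (@card_inter_edge _ _ _ [set v; next s y]).
- exact: hS.1.
- exact: hS.1.
- apply/eqP => /(link_edge_inj us ss ys nys vy vny) E.
  by have := next_next_neq us ss ys; rewrite -E eqxx.
- by rewrite subUset !sub1set !inE !eqxx !orbT.
- by rewrite subUset !sub1set !inE !eqxx !orbT.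
- by rewrite cards2 nvy.
Qed.

(** * Exhaustive search *)

(* A state (n, m, L) describes part of the bijection f: labels below n (below m)
   stand for distinct vertices of the first (second) surface, and L lists pairs
   of triangles, as lists of labels, that correspond to each other under f. *)
Definition state : Type := nat * nat * seq (seq nat * seq nat).

Definition nlabels1 (st : state) : nat := st.1.1.

Definition nlabels2 (st : state) : nat := st.1.2.

Definition pairs (st : state) : seq (seq nat * seq nat) := st.2.

Definition common (a b : seq nat) : nat := count (mem b) a.

(* The second conjunct: no edge of the second surface is in three triangles. *)
Definition admissible (L : seq (seq nat * seq nat)) (c c' : seq nat) : bool :=
  all (fun p => (common c p.1 == common c' p.2) && (common c p.1 < 3)) L &&
  all (fun p => all (fun q => (common p.2 q.2 < 3) ==>
    (count (fun i => (i \in p.2) && (i \in q.2)) c' < 2)) L) L.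

(* A new vertex always receives the least unused label, hence the bounds
   n+1 and m+1. *)
Definition extensions (st : state) (e e' : seq nat) : seq state :=
  [seq (maxn (nlabels1 st) z.1.+1, maxn (nlabels2 st) z.2.+1,
      (rcons e z.1, rcons e' z.2) :: pairs st)
  | z <- [seq z <- [seq (u, u') | u <- iota 0 (nlabels1 st).+1,
                                  u' <- iota 0 (nlabels2 st).+1] |
      [&& z.1 \notin e, z.2 \notin e' &
      admissible (pairs st) (rcons e z.1) (rcons e' z.2)]]].

Definition edges (a : seq nat) : seq (seq nat) := [seq rem i a | i <- a].

(** The bound 3 excludes [a] itself, so a second listed triangle over [e] is required. *)
Definition closed_edge (L : seq (seq nat * seq nat)) (a e : seq nat) : bool :=
  has (fun q => (common a q.1 < 3) && all (mem q.1) e) L.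

Definition open_edges (L : seq (seq nat * seq nat)) :=
  [seq z <- [seq (p, e) | p <- L, e <- edges p.1] |
    ~~ closed_edge L z.1.1 z.2].

(* The fuel k need not suffice for the result to be sound: that the leaves have
   no open edge left is checked afterwards. *)
Fixpoint search (k : nat) (st : state) : seq state :=
  if k is k'.+1 then
    if open_edges (pairs st) is (p, e) :: _ then
      flatten [seq search k' st' |
        st' <- flatten [seq extensions st e e' | e' <- edges p.2]]
    else [:: st]
  else [:: st].

(** The flipped edge is 12, with opposite vertices 0 and 3. Labels in the second surface are chosen
    so that transfer at the first triangle preserves labels. *)
Definition start : state := (4, 4,
  [:: ([:: 0; 1; 2], [:: 0; 1; 2]); ([:: 1; 2; 3], [:: 1; 2; 3])]).

(* The flip: the triangle over the edge 01 goes to one over 01, but the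
   triangle over 13 goes to one over 23. *)
Definition leaves : seq state := flatten [seq search 12 st | st <-
  flatten [seq extensions st [:: 1; 3] [:: 2; 3] |
    st <- extensions start [:: 0; 1] [:: 0; 1]]].

Lemma three_triangles (V : finType) (T : {set {set V}}) (t1 t2 t3 : {set V}) :
  triangulated_closed_surface T -> t1 \in T -> t2 \in T -> t3 \in T ->
  t1 != t2 -> t3 != t1 -> t3 != t2 -> #|t3 :&: (t1 :&: t2)| < 2.
Proof.
move=> hS t1T t2T t3T n12 n31 n32; rewrite ltnNge; apply/negP.
case/card_gt1P => v [w []]; rewrite !inE.
move=> /and3P[v3 v1 v2] /and3P[w3 w1 w2] nvw.
have sub (t : {set V}) : v \in t -> w \in t -> [set v; w] \subset t.
  by move=> vt wt; rewrite subUset !sub1set vt.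
have c2 : #|[set v; w]| = 2 by rewrite cards2 nvw.
have [s [sT _ _ us]] := two_triangles_at_edge hS t1T (sub _ v1 w1) c2.
have := us _ t2T (sub _ v2 w2); rewrite eq_sym (negbTE n12) => /eqP t2s.
by have := us _ t3T (sub _ v3 w3); rewrite (negbTE n31) -t2s (negbTE n32).
Qed.

(** * Labels and the vertex sets they name *)

Definition im (V : finType) (x : nat -> V) (a : seq nat) : {set V} :=
  [set:: map x a].

Definition triple (n : nat) (a : seq nat) : bool :=
  [&& uniq a, size a == 3 & all (gtn n) a].

Lemma eq_in_im (V : finType) (x y : nat -> V) (a : seq nat) :
  {in a, x =1 y} -> im x a = im y a.
Proof. by move=> /eq_in_map; rewrite /im => ->. Qed.

Lemma im_sub (V : finType) (x : nat -> V) (a : seq nat) (A : {set V}) :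
  (im x a \subset A) = all (fun i => x i \in A) a.
Proof.
apply/subsetP/allP => [sA i ia|sA v]; first by apply: sA; rewrite inE map_f.
by rewrite inE => /mapP[i ia ->]; apply: sA.
Qed.

(** Injectivity of the labelling turns cardinals of intersections into counts on lists; this links
    the Boolean tests of the search to the surfaces. *)
Lemma card_imI (V : finType) (x : nat -> V) n (a : seq nat) (A : {set V}) :
  {in gtn n &, injective x} -> uniq a -> all (gtn n) a ->
  #|im x a :&: A| = count (fun i => x i \in A) a.
Proof.
move=> xI ua /allP an.
have -> : im x a :&: A = im x [seq i <- a | x i \in A].
  apply/setP => v; rewrite !inE; apply/andP/mapP => [[/mapP[i ia ->] xA]|[i]].
    by exists i; rewrite ?mem_filter ?xA.
  by rewrite mem_filter => /andP[xA ia] ->; rewrite map_f.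
rewrite cardsE -size_filter -(size_map x); apply/card_uniqP.
rewrite map_inj_in_uniq ?filter_uniq // => i j.
by rewrite !mem_filter => /andP[_ /an ia] /andP[_ /an ja]; apply: xI.
Qed.

Lemma card_im (V : finType) (x : nat -> V) n (a : seq nat) :
  {in gtn n &, injective x} -> uniq a -> all (gtn n) a -> #|im x a| = size a.
Proof.
by move=> xI ua an; rewrite -(setIT (im x a)) (card_imI _ xI) // -count_predT;
  apply: eq_count => i; rewrite inE.
Qed.

Lemma mem_im (V : finType) (x : nat -> V) n (a : seq nat) (i : nat) :
  {in gtn n &, injective x} -> all (gtn n) a -> i < n ->
  (x i \in im x a) = (i \in a).
Proof.
move=> xI /allP an ni; rewrite inE; apply/mapP/idP => [[j ja xE]|ia].
  by rewrite (xI i j) // inE; apply: (an j).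
by exists i.
Qed.

Lemma common_im (V : finType) (x : nat -> V) n (a b : seq nat) :
  {in gtn n &, injective x} -> uniq a -> all (gtn n) a -> all (gtn n) b ->
  common a b = #|im x a :&: im x b|.
Proof.
move=> xI ua an bn; rewrite (card_imI _ xI) //; apply: eq_in_count => i ia.
by rewrite (mem_im xI) //; apply: (allP an).
Qed.

(** A vertex that is already labelled keeps its label [u < n], and the bound stays [n]; otherwise it
    receives [u = n], and the bound becomes [n.+1]. The [maxn] covers both cases. *)
Lemma add_label (V : finType) (x : nat -> V) n (v : V) :
  {in gtn n &, injective x} -> exists x' u, [/\ u <= n, x' u = v,
    {in gtn n, x' =1 x} & {in gtn (maxn n u.+1) &, injective x'}].
Proof.
move=> xI; have [/mapP[u]|nv] := boolP (v \in map x (iota 0 n)).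
  rewrite mem_iota => /andP[_ un] ->; exists x, u; split => //; first exact: ltnW.
  by rewrite (maxn_idPl _).
exists (fun k => if k == n then v else x k), n; rewrite eqxx; split => //.
  by move=> k; rewrite inE => /ltn_eqF ->.
have nx k : k < n -> x k != v.
  by move=> kn; apply: contraNneq nv => <-; rewrite map_f // mem_iota.
have -> : maxn n n.+1 = n.+1 by apply/maxn_idPr.
move=> i j; rewrite !inE !ltnS (leq_eqVlt i) (leq_eqVlt j).
case: (i =P n) (j =P n) => [->|_] [->|_] //= ni nj E; last exact: xI.
  by have := nx _ nj; rewrite E eqxx.
by have := nx _ ni; rewrite E eqxx.
Qed.

Lemma triple_rcons n (e : seq nat) u :
  uniq e -> size e = 2 -> all (gtn n) e -> u \notin e ->
  triple (maxn n u.+1) (rcons e u).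
Proof.
move=> ue se en nu; rewrite /triple rcons_uniq nu ue size_rcons se /= all_rcons.
rewrite /= leq_maxr; apply/allP => i /(allP en) /= ni.
exact: leq_trans ni (leq_maxl _ _).
Qed.

Lemma complete_triangle (V : finType) (x : nat -> V) n (e : seq nat)
    (r : {set V}) :
  {in gtn n &, injective x} -> uniq e -> size e = 2 -> all (gtn n) e ->
  im x e \subset r -> #|r| = 3 ->
  exists x' u, [/\ u <= n, u \notin e, im x' (rcons e u) = r,
    {in gtn n, x' =1 x} & {in gtn (maxn n u.+1) &, injective x'}].
Proof.
move=> xI ue se en er r3.
have /cards1P[v vE] : #|r :\: im x e| == 1.
  by rewrite cardsD (setIidPr er) (card_im xI) // r3 se.
have := set11 v; rewrite -vE inE => /andP[ve vr].
have [x' [u [un xu xx xI']]] := add_label v xI.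
have ime : im x' e = im x e by apply: eq_in_im => i /(allP en); apply: xx.
exists x', u; split => //.
  by apply: contra ve => ue'; rewrite -xu -ime inE map_f.
have -> : im x' (rcons e u) = v |: im x' e.
  by apply/setP => w; rewrite !inE map_rcons mem_rcons in_cons xu.
by rewrite ime -vE -{2}(setID r (im x e)) (setIidPr er) setUC.
Qed.

(** * Soundness of the search *)

Section Search.

Variables (V V' : finType) (T : {set {set V}}) (T' : {set {set V'}}).
Hypotheses (hS : triangulated_closed_surface T)
           (hS' : triangulated_closed_surface T').
Variable F : {set V} -> {set V'}.
Hypothesis FT : forall t, t \in T -> F t \in T'.
Hypothesis FI : forall t r, t \in T -> r \in T -> #|F t :&: F r| = #|t :&: r|.

(** Distinct triangles meet in fewer than three vertices, whereas equal images meet in three. *)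
Lemma F_inj : {in T &, injective F}.
Proof.
move=> t r tT rT E; apply/eqP; apply: contraT => /card_inter_lt.
move=> /(_ 3 (hS.1 _ tT) (hS.1 _ rT)).
by rewrite -FI // E setIid (hS'.1 _ (FT rT)).
Qed.

Definition realizes (st : state) (x : nat -> V) (y : nat -> V') : Prop :=
  [/\ {in gtn (nlabels1 st) &, injective x}, {in gtn (nlabels2 st) &, injective y} &
    forall p, p \in pairs st ->
      [/\ triple (nlabels1 st) p.1, triple (nlabels2 st) p.2,
          im x p.1 \in T & F (im x p.1) = im y p.2]].

Lemma triple_widen n m a : n <= m -> triple n a -> triple m a.
Proof.
move=> nm /and3P[ua sa /allP an]; apply/and3P; split => //.
by apply/allP => i /an /= ni; apply: leq_trans nm.
Qed.

(** Labelling the third vertices of [r] and [F r] gives an extension that passes both tests: the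
    first because [F] preserves intersection sizes, the second because no edge of the second surface
    lies in three triangles. *)
Lemma extensions_sound st x y (r : {set V}) (e e' : seq nat) :
  realizes st x y -> r \in T ->
  (forall p, p \in pairs st -> im x p.1 != r) ->
  uniq e -> size e = 2 -> all (gtn (nlabels1 st)) e -> im x e \subset r ->
  uniq e' -> size e' = 2 -> all (gtn (nlabels2 st)) e' -> im y e' \subset F r ->
  exists st' x' y', [/\ st' \in extensions st e e', realizes st' x' y',
    {in gtn (nlabels1 st), x' =1 x}, {in gtn (nlabels2 st), y' =1 y} &
    exists c c', im x' c = r /\ pairs st' = (c, c') :: pairs st].
Proof.
case=> xI yI rL rT rnew ue se en er ue' se' en' er'.
have [x' [u [un nu cr xx xI']]] :=
  complete_triangle xI ue se en er (hS.1 _ rT).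
have [y' [u' [un' nu' cr' yy yI']]] :=
  complete_triangle yI ue' se' en' er' (hS'.1 _ (FT rT)).
set c := rcons e u in cr; set c' := rcons e' u' in cr'.
set n := maxn _ _ in xI'; set m := maxn _ _ in yI'.
have tc : triple n c by apply: triple_rcons.
have tc' : triple m c' by apply: triple_rcons.
have rL' p : p \in pairs st ->
    [/\ triple n p.1, triple m p.2, im x' p.1 \in T, im x' p.1 != r &
        F (im x' p.1) = im y' p.2].
  move=> pL; have [t1 t2 pT pF] := rL p pL.
  have -> : im x' p.1 = im x p.1.
    by apply: eq_in_im => i; case/and3P: t1 => _ _ /allP t1 /t1; apply: xx.
  have -> : im y' p.2 = im y p.2.
    by apply: eq_in_im => i; case/and3P: t2 => _ _ /allP t2 /t2; apply: yy.
  by split=> //; rewrite ?rnew //; [apply: triple_widen t1|apply: triple_widen t2];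
    apply: leq_maxl.
have /and3P[uc _ cn] := tc; have /and3P[uc' _ cm] := tc'.
exists ((n, m, (c, c') :: pairs st)), x', y'; split => //; last first.
- by exists c, c'.
- split=> //= p; rewrite inE => /predU1P[->|/rL'[]//].
  by rewrite /= cr cr'.
apply/mapP; exists (u, u') => //; rewrite mem_filter.
apply/andP; split; last first.
  apply: (allpairs_f pair); by rewrite mem_iota /= add0n ltnS.
rewrite /= nu nu' -/c -/c' /=; apply/andP; split; apply/allP => p pL.
  have [/and3P[up _ pn] /and3P[up' _ pm] pT pr pF] := rL' _ pL.
  rewrite (common_im xI') // (common_im yI') // cr cr' -pF FI // eqxx /=.
  by apply: card_inter_lt; rewrite ?hS.1 1?eq_sym.
(* Second test: the images of [p], [q] and [r] are three distinct triangles, since [F] is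
   injective. *)
have [_ /and3P[up sp pm] pT pr pF] := rL' _ pL.
apply/allP => q qL; apply/implyP.
have [_ /and3P[uq sq qm] qT qr qF] := rL' _ qL.
rewrite (common_im yI') // => pq.
have -> : count (fun i => (i \in p.2) && (i \in q.2)) c' =
    #|im y' c' :&: (im y' p.2 :&: im y' q.2)|.
  rewrite (card_imI _ yI') //; apply: eq_in_count => i /(allP cm) im.
  by rewrite in_setI !(mem_im yI').
rewrite cr' -pF -qF; apply: (three_triangles hS'); rewrite ?FT //.
- apply: contraTneq pq; rewrite -pF -qF => ->.
  by rewrite setIid (hS'.1 _ (FT qT)).
- by apply: contraNneq pr => /F_inj -> //.
- by apply: contraNneq qr => /F_inj -> //.
Qed.

Lemma edgesP n a e : triple n a -> e \in edges a ->
  [/\ uniq e, size e = 2, all (gtn n) e & {subset e <= a}].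
Proof.
move=> /and3P[ua /eqP sa /allP an] /mapP[i ia ->]; split.
- exact: rem_uniq.
- by rewrite size_rem ?sa.
- by apply/allP => j /mem_rem /an.
- exact: mem_rem.
Qed.

(** Exactly one of the three labels names a vertex outside [A]; removing it leaves the wanted
    edge. *)
Lemma sub2_edge (W : finType) (z : nat -> W) n (b : seq nat) (A : {set W}) :
  {in gtn n &, injective z} -> triple n b -> #|im z b :&: A| = 2 ->
  exists2 e, e \in edges b & im z e \subset A.
Proof.
move=> zI /and3P[ub /eqP sb bn]; rewrite (card_imI _ zI) // => c2.
have : ~~ all (fun i => z i \in A) b by rewrite all_count c2 sb.
rewrite -has_predC => /hasP[i ib /= zi].
exists (rem i b); first exact: map_f.
rewrite im_sub all_count size_rem // sb eq_sym; apply/eqP.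
have /permP/(_ (fun j => z j \in A)) := perm_to_rem ib.
by rewrite c2 /= (negbTE zi) add0n.
Qed.

Lemma im_subset (W : finType) (z : nat -> W) (a b : seq nat) :
  {subset a <= b} -> im z a \subset im z b.
Proof. by move=> ab; rewrite im_sub; apply/allP => i /ab ib; rewrite inE map_f. Qed.

(** The actual triangle [r] across the first open edge is one that the search tries: [F r] shares
    some edge with the image of the current triangle, and all three edges are tried. *)
Lemma search_sound k st x y : realizes st x y ->
  exists2 st', st' \in search k st & exists x' y', realizes st' x' y'.
Proof.
elim: k st x y => [|k IH] st x y rs /=.
  by exists st; [rewrite inE | exists x, y].
case E: (open_edges _) => [|[p e] os].
  by exists st; [rewrite inE | exists x, y].
have : (p, e) \in open_edges (pairs st) by rewrite E inE eqxx.
rewrite mem_filter /= => /andP[/hasPn ope /allpairsPdep[p1 [e1 [pL eb [? ?]]]]].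
subst p1 e1.
have [xI yI rL] := rs; have [t1 t2 pT pF] := rL _ pL.
have [ue se en ep] := edgesP t1 eb.
have [r [rT rp er _]] : exists s, [/\ s \in T, s != im x p.1, im x e \subset s &
    forall r, r \in T -> im x e \subset r -> (r == im x p.1) || (r == s)].
  by apply: two_triangles_at_edge; rewrite ?im_subset ?(card_im xI).
have c2 : #|im x p.1 :&: r| = 2.
  apply: (@card_inter_edge _ _ _ (im x e) (hS.1 _ pT) (hS.1 _ rT)) => //.
  - by rewrite eq_sym.
  - exact: im_subset.
  - by rewrite (card_im xI).
have [e' eb' er'] : exists2 e', e' \in edges p.2 & im y e' \subset F r.
  by apply: (sub2_edge yI) => //; rewrite -pF FI.
have [ue' se' en' _] := edgesP t2 eb'.
have [st' [x' [y' [st'e rs' _ _ _]]]] : exists st' x' y',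
    [/\ st' \in extensions st e e', realizes st' x' y',
    {in gtn (nlabels1 st), x' =1 x}, {in gtn (nlabels2 st), y' =1 y} &
    exists c c', im x' c = r /\ pairs st' = (c, c') :: pairs st].
  (* As the edge is open, [r] cannot be listed already: a listed [r] would close it. *)
  apply: (extensions_sound rs rT _ ue se en er ue' se' en' er') => q qL.
  have [/and3P[uq sq qn] _ qT qF] := rL _ qL.
  apply: contraNneq (ope q qL) => qr; apply/andP; split.
    have /and3P[up _ pn] := t1; rewrite (common_im xI) // qr.
    by rewrite c2.
  apply/allP => i ie; rewrite inE -(mem_im xI qn); last exact: (allP en).
  by rewrite qr; move: er; rewrite im_sub => /allP; apply.
have [st2 st2s [x2 [y2 rs2]]] := IH _ _ _ rs'.
exists st2; last by exists x2, y2.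
apply/flatten_mapP; exists st' => //.
by apply/flatten_mapP; exists e'.
Qed.

(** The labels occurring in [L] name the vertices bijectively, so [L] determines the complex up to
    isomorphism. *)
Definition presents (W : finType) (M : {set {set W}}) (z : nat -> W)
    (L : seq (seq nat)) : Prop :=
  [/\ {in flatten L &, injective z}, forall w, exists2 i, i \in flatten L & w = z i
    & M = [set:: map (im z) L]].

(* If every edge at the listed triangles is closed, the listed triangles are a
   union of whole vertex links, hence all of T by connectedness. *)
Lemma closed_presents st x y :
  connected_complex T -> (forall t', t' \in T' -> exists2 t, t \in T & F t = t') ->
  realizes st x y -> 0 < size (pairs st) -> open_edges (pairs st) = [::] ->
  presents T x (unzip1 (pairs st)) /\ presents T' y (unzip2 (pairs st)).
Proof.
move=> [_ cT] Fsurj [xI yI rL] L0 cl.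
have flat1 i : i \in flatten (unzip1 (pairs st)) -> i < nlabels1 st.
  case/flattenP => a /mapP[p pL ->]; have [/and3P[_ _ /allP an] _ _ _] := rL _ pL.
  exact: an.
have flat2 i : i \in flatten (unzip2 (pairs st)) -> i < nlabels2 st.
  case/flattenP => a /mapP[p pL ->]; have [_ /and3P[_ _ /allP an] _ _] := rL _ pL.
  exact: an.
pose K := [set:: map (im x) (unzip1 (pairs st))].
have KP t : reflect (exists2 p, p \in pairs st & t = im x p.1) (t \in K).
  rewrite inE -map_comp; exact: mapP.
have KT t : t \in K -> t \in T by case/KP => p /rL[_ _ pT _] ->.
(* The shared edge is closed, so a second listed triangle lies over it; as only two triangles do,
   that one is [r]. *)
have Kadj t r : t \in K -> r \in T -> #|t :&: r| = 2 -> r \in K.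
  case/KP => p pL -> rT tr; have [t1 _ pT _] := rL _ pL.
  have [e ea er] := sub2_edge xI t1 tr.
  have [ue se en ep] := edgesP t1 ea.
  have : closed_edge (pairs st) p.1 e.
    apply: contraT => op; have : (p, e) \in open_edges (pairs st).
      by rewrite mem_filter op /=; apply: allpairs_f_dep.
    by rewrite cl.
  case/hasP => q qL /andP[qp eq]; have [tq _ qT _] := rL _ qL.
  have /and3P[uq _ qn] := tq; have /and3P[up _ pn] := t1.
  have ep' := im_subset x ep.
  have eq' : im x e \subset im x q.1 by apply: im_subset; apply/allP.
  have [s [sT _ _ us]] := two_triangles_at_edge hS pT ep' 
    (etrans (card_im xI ue en) se).
  have nqp : im x q.1 != im x p.1.
    apply: contraTneq qp => qp; rewrite (common_im xI) // qp setIid.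
    by rewrite hS.1.
  have nrp : r != im x p.1.
    by apply: contra_eqN tr => /eqP ->; rewrite setIid hS.1.
  have := us _ qT eq'; rewrite (negbTE nqp) => /eqP qs.
  have := us _ rT er; rewrite (negbTE nrp) -qs => /eqP ->.
  by apply/KP; exists q.
have Kv v t r : t \in K -> v \in t -> r \in T -> v \in r -> r \in K.
  move=> tK vt; move: r; apply: (@link_connected _ T v (mem K) t) => //.
    by move=> t1 r1 t1T r1T _ _ c2 t1K; apply: Kadj c2.
  exact: KT.
have [t0 t0K] : exists t, t \in K.
  case E: (pairs st) L0 => [//|p L] _; exists (im x p.1).
  by apply/KP; exists p; rewrite // E inE eqxx.
have [v0 v0t] : exists v, v \in t0.
  by apply/set0Pn; rewrite -card_gt0 hS.1 // KT.
(* Along a path of vertices from [v0], a triangle over each edge contains a vertex already reached,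
   hence lies in [K] and reaches the next vertex. *)
have KA v t : t \in T -> v \in t -> t \in K.
  suff: exists2 r, r \in K & v \in r.
    by case=> r rK vr tT vt; apply: Kv vr tT vt.
  have /connectP[s] := cT v0 v; elim: s v0 t0 t0K v0t => [|w s IH] v0 t0 t0K v0t /=.
    by move=> _ ->; exists t0.
  case/andP => /andP[_ /existsP[r /andP[rT]]]; rewrite subUset !sub1set.
  by case/andP => v0r wr ws vl; apply: (IH w r) => //; apply: Kv v0t rT v0r.
have TK : T = K.
  apply/setP => t; apply/idP/idP => [tT|/KT//].
  have [v vt] : exists v, v \in t by apply/set0Pn; rewrite -card_gt0 hS.1.
  exact: KA vt.
have TK' : T' = [set:: map (im y) (unzip2 (pairs st))].
  apply/setP => t'; rewrite !inE -map_comp; apply/idP/mapP => [/Fsurj[t]|[p pL ->]].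
    by rewrite TK => /KP[p pL ->] <-; exists p => //; have [_ _ _] := rL _ pL.
  by have [_ _ pT /= <-] := rL _ pL; apply: FT.
split; split => //.
- by move=> i j /flat1 ni /flat1 nj; apply: xI.
- move=> v; have [t tT vt] := vertex_in_triangle v hS; move: tT vt; rewrite TK.
  case/KP => p pL ->; rewrite inE => /mapP[i ip ->]; exists i => //.
  by apply/flatten_mapP; exists p.
- by move=> i j /flat2 ni /flat2 nj; apply: yI.
- move=> v; have [t tT vt] := vertex_in_triangle v hS'; move: tT vt; rewrite TK' inE -map_comp.
  case/mapP => p pL -> /=; rewrite inE => /mapP[i ip ->]; exists i => //.
  by apply/flatten_mapP; exists p.
Qed.

End Search.

(** * Recognising the models *)

(** Sorting lets label lists be compared as sets, and [perm_eq] ignores the order of the triangles.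
    The second conjunct is injectivity of [pi] on the labels in use. *)
Definition relabels (pi : nat -> nat) (L M : seq (seq nat)) : bool :=
  perm_eq [seq sort leq (map pi a) | a <- L] [seq sort leq a | a <- M] &&
  all (fun i => all (fun j => (pi i == pi j) ==> (i == j)) (flatten L))
    (flatten L).

Lemma im_sort (W : finType) (z : nat -> W) a : im z (sort leq a) = im z a.
Proof. by apply/setP => w; rewrite !inE; apply/eq_mem_map/mem_sort. Qed.

Lemma mem_flatten_sort (L : seq (seq nat)) i :
  (i \in flatten [seq sort leq a | a <- L]) = (i \in flatten L).
Proof.
apply/flatten_mapP/flattenP => -[a aL]; rewrite ?mem_sort; first by exists a.
by exists a; rewrite ?mem_sort.
Qed.

Lemma map_im_sort (W : finType) (z : nat -> W) (L : seq (seq nat)) :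
  map (im z) [seq sort leq a | a <- L] = map (im z) L.
Proof. by rewrite -map_comp; apply: eq_map => a /=; rewrite im_sort. Qed.

Lemma presents_relabel (W : finType) (M : {set {set W}}) (z : nat -> W) pi L L0 :
  presents M z L0 -> relabels pi L L0 -> presents M (z \o pi) L.
Proof.
case=> zI zS ME /andP[LE /allP piI].
have flat i : (i \in flatten L0) = (i \in map pi (flatten L)).
  rewrite -mem_flatten_sort map_flatten -(mem_flatten_sort (map (map pi) L)).
  rewrite -map_comp; apply/flattenP/flattenP => -[a aL ia]; exists a => //;
    by rewrite (perm_mem LE) in aL *.
split=> [i j iL jL|w|].
- move=> /= /zI; rewrite !flat !map_f // => /(_ isT isT) E; apply/eqP.
  by move/allP: (piI i iL) => /(_ j jL); rewrite E eqxx.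
- have [i] := zS w; rewrite flat => /mapP[j jL ->] ->; by exists j.
- have imE a : im (z \o pi) a = im z (map pi a) by rewrite /im map_comp.
  rewrite ME; apply/setP => A; rewrite !inE (eq_map imE).
  have /perm_mem/(_ A) := perm_map (im z) LE.
  rewrite (map_comp (sort leq)) !map_im_sort => E.
  by apply: etrans (esym E) _; rewrite -map_comp.
Qed.

(** The isomorphism sends a vertex to its label and the label to the vertex it names on the other
    side. Triangles correspond, and the other simplices follow as their nonempty subsets. *)
Lemma presents_isomorphic (V W : finType) (T : {set {set V}}) (M : {set {set W}})
    (x : nat -> V) (z : nat -> W) L :
  presents T x L -> presents M z L -> isomorphic T M.
Proof.
have lift (U : finType) (X : {set {set U}}) (y : nat -> U) : presents X y L ->
    exists r : U -> nat, (forall u, y (r u) = u) /\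
      (forall u, r u \in flatten L) /\ {in flatten L, cancel y r}.
  case=> yI yS _; pose r u := nth 0 (flatten L) (index u (map y (flatten L))).
  have ix u : u \in map y (flatten L) by have [i iL ->] := yS u; apply: map_f.
  have rL u : r u \in flatten L.
    by rewrite mem_nth // -(size_map y) index_mem.
  have yr u : y (r u) = u.
    by rewrite -(nth_map 0 u) ?nth_index // -(size_map y) index_mem.
  by exists r; do !split => //; move=> i iL; apply: yI.
move=> pT pM; have [r [yr [rL ry]]] := lift _ _ _ pT.
have [q [zq [qL qz]]] := lift _ _ _ pM.
have [_ _ TE] := pT; have [_ _ ME] := pM.
have gK : cancel (z \o r) (x \o q) by move=> v; rewrite /= qz ?yr.
have Kg : cancel (x \o q) (z \o r) by move=> w; rewrite /= ry ?zq.
have gE a : a \in L -> (z \o r) @: im x a = im z a.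
  move=> aL; have zr i : i \in a -> (z \o r) (x i) = z i.
    by move=> ia; rewrite /= ry //; apply/flattenP; exists a.
  apply/setP => w; apply/imsetP/idP => [[v]|]; rewrite inE.
    by case/mapP => i ia -> ->; rewrite zr // inE map_f.
  by case/mapP => i ia ->; exists (x i); rewrite ?zr // inE map_f.
exists (z \o r); split; first by exists (x \o q).
move=> A; rewrite /is_simplex imset_eq0; congr (_ && _).
apply/existsP/existsP => -[t /andP[tT At]].
  move: tT; rewrite ME inE => /mapP[a aL tE]; exists (im x a).
  rewrite TE inE map_f //=; move: At; rewrite tE -gE // => /subsetP At.
  by apply/subsetP => v vA; rewrite -(mem_imset _ _ (can_inj gK)) At ?imset_f.
move: tT; rewrite TE inE => /mapP[a aL tE]; exists (im z a).
by rewrite ME inE map_f //= -gE // imsetS // -tE.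
Qed.

(* The label k < n stands for a_k and the label n for x. *)
Definition cone_label (n k : nat) : option 'Z_n :=
  if k < n then Some (inZp k) else None.

Definition half_icosahedron_labels : seq (seq nat) :=
  [seq [:: i; (i + 1) %% 5; 5] | i <- iota 0 5] ++
  [seq [:: i; (i + 1) %% 5; (i + 3) %% 5] | i <- iota 0 5].

Definition triangulated_half_cube_labels : seq (seq nat) :=
  [seq [:: i; (i + 1) %% 6; 6] | i <- iota 0 6] ++
  [:: [:: 0; 1; 4]; [:: 1; 2; 4]; [:: 2; 3; 0]; [:: 3; 4; 0]; [:: 4; 5; 2];
      [:: 0; 5; 2]].

Lemma im3 (W : finType) (z : nat -> W) i j k :
  im z [:: i; j; k] = [set z i; z j; z k].
Proof. by apply/setP => w; rewrite !inE orbA. Qed.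

Lemma cone_label_inj n : 1 < n -> {in gtn n.+1 &, injective (cone_label n)}.
Proof.
move=> n1 i j; rewrite !inE !ltnS /cone_label.
case: (ltnP i n) (ltnP j n) => [ni|ni] [nj|nj] //= i1 j1.
  by case; rewrite Zp_cast // !modn_small.
by move=> _; apply/eqP; rewrite eqn_leq (leq_trans i1) // (leq_trans j1).
Qed.

Lemma cone_label_surj n (w : option 'Z_n) : 1 < n ->
  exists2 i, i < n.+1 & w = cone_label n i.
Proof.
move=> n1; case: w => [i|]; last by exists n; rewrite // /cone_label ltnn.
have ni : i < n by rewrite -[X in _ < X](Zp_cast n1).
by exists i; [apply: ltnW | rewrite /cone_label ni valZpK].
Qed.

Lemma cone_label_add n k (i : 'Z_n) : 1 < n ->
  cone_label n ((i + k) %% n) = Some (i + k%:R)%R.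
Proof.
case: n i => [|[|n]] // i _; rewrite /cone_label ltn_mod; congr Some.
by apply: val_inj; rewrite /= Zp_nat /= modn_mod modnDmr.
Qed.

Lemma cone_label_ord n (i : 'Z_n) : 1 < n -> cone_label n i = Some i.
Proof.
move=> n1; have ni : i < n by rewrite -[X in _ < X](Zp_cast n1).
by rewrite /cone_label ni valZpK.
Qed.

Lemma imset_cone_label n (f : 'Z_n -> {set option 'Z_n}) (g : nat -> seq nat) :
  1 < n -> (forall i : 'Z_n, f i = im (cone_label n) (g i)) ->
  [set f i | i : 'Z_n] = [set:: map (im (cone_label n)) (map g (iota 0 n))].
Proof.
case: n f => [|[|n]] // f _ fE; apply/setP => A; rewrite inE -map_comp.
apply/imsetP/mapP => [[i _ ->]|[i]].
  by exists (val i); rewrite ?fE // mem_iota add0n ltn_ord.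
rewrite mem_iota add0n /= => ni ->; exists (inZp i) => //.
by rewrite fE /= modn_small.
Qed.

Lemma set_seqU (W : finType) (s1 s2 : seq W) :
  [set:: s1 ++ s2] = [set:: s1] :|: [set:: s2].
Proof. by apply/setP => w; rewrite !inE mem_cat. Qed.

Lemma half_icosahedron_presents :
  presents half_icosahedron (cone_label 5) half_icosahedron_labels.
Proof.
have fl i : (i \in flatten half_icosahedron_labels) = (i < 6).
  by move: i; do 6!case=> //.
split=> [i j|w|].
- by rewrite !fl; apply: (@cone_label_inj 5).
- by have [//|i i6 ->] := @cone_label_surj 5 w; exists i; rewrite ?fl.
rewrite /half_icosahedron_labels map_cat set_seqU; congr (_ :|: _);
  by apply: imset_cone_label => // i; rewrite im3 !cone_label_add // cone_label_ord.
Qed.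

Lemma triangulated_half_cube_presents :
  presents triangulated_half_cube (cone_label 6) triangulated_half_cube_labels.
Proof.
have fl i : (i \in flatten triangulated_half_cube_labels) = (i < 7).
  by move: i; do 7!case=> //.
split=> [i j|w|].
- by rewrite !fl; apply: (@cone_label_inj 6).
- by have [//|i i6 ->] := @cone_label_surj 6 w; exists i; rewrite ?fl.
rewrite /triangulated_half_cube_labels map_cat set_seqU; congr (_ :|: _).
  by apply: imset_cone_label => // i; rewrite im3 !cone_label_add // cone_label_ord.
have tri (i j k : nat) : i < 6 -> j < 6 -> k < 6 ->
    tri6 i%:R%R j%:R%R k%:R%R = im (cone_label 6) [:: i; j; k].
  move=> i6 j6 k6; rewrite im3 /tri6 /cone_label i6 j6 k6.
  by rewrite !Zp_nat.
apply/setP => A; rewrite !inE /= -!tri //.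
by rewrite !orbA.
Qed.

(** * Flips *)

Section Flip.

Variables (V V' : finType) (T : {set {set V}}) (T' : {set {set V'}}).
Hypotheses (hS : triangulated_closed_surface T)
           (hS' : triangulated_closed_surface T').
Variable F : {set V} -> {set V'}.
Hypothesis FT : forall t, t \in T -> F t \in T'.
Hypothesis FI : forall t r, t \in T -> r \in T -> #|F t :&: F r| = #|t :&: r|.

(** The neighbour across the side of [t] facing [v]. The default [t] does not occur for a triangle
    [t] of [T] and a vertex [v] of [t]. *)
Definition opposite (t : {set V}) (v : V) : {set V} :=
  odflt t [pick s in T | (s != t) && (t :\ v \subset s)].

Definition transfer (t : {set V}) (v : V) : {set V'} :=
  F t :\: F (opposite t v).

Lemma card_side t v : t \in T -> v \in t -> #|t :\ v| = 2.
Proof. by move=> tT vt; have := hS.1 _ tT; rewrite (cardsD1 v) vt => -[]. Qed.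

Lemma oppositeP t v : t \in T -> v \in t ->
  [/\ opposite t v \in T, opposite t v != t, t :\ v \subset opposite t v,
      v \notin opposite t v &
      forall r, r \in T -> r != t -> t :\ v \subset r -> r = opposite t v].
Proof.
move=> tT vt.
have [s [sT st tvs us]] :=
  two_triangles_at_edge hS tT (subsetDl t [set v]) (card_side tT vt).
have -> : opposite t v = s.
  rewrite /opposite; case: pickP => [r /and3P[rT rt tvr]|/(_ s)].
    by have := us _ rT tvr; rewrite (negbTE rt) => /eqP.
  by rewrite sT st tvs.
split=> //; last first.
  by move=> r rT rt tvr; have := us _ rT tvr; rewrite (negbTE rt) => /eqP.
apply: contra st => vs; rewrite eq_sym eqEcard !hS.1 // andbT.
by rewrite -(setD1K vt) subUset sub1set vs.
Qed.

Lemma card_opposite t v : t \in T -> v \in t -> #|t :&: opposite t v| = 2.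
Proof.
move=> tT vt; have [oT ot tvo _ _] := oppositeP tT vt.
apply: (@card_inter_edge _ _ _ (t :\ v) (hS.1 _ tT) (hS.1 _ oT)) => //.
- by rewrite eq_sym.
- exact: subsetDl.
- exact: card_side.
Qed.

Lemma card_transfer t v : t \in T -> v \in t -> #|transfer t v| = 1.
Proof.
move=> tT vt; have [oT _ _ _ _] := oppositeP tT vt.
by rewrite cardsD (hS'.1 _ (FT tT)) FI // card_opposite.
Qed.

Lemma transfer_sub t v : transfer t v \subset F t.
Proof. exact: subsetDl. Qed.

(** With equal transfers, [F t] would meet the images of two different neighbours in the same edge,
    which would then lie in three triangles. *)
Lemma transfer_inj t : t \in T -> {in t &, injective (transfer t)}.
Proof.
move=> tT v w vt wt E; apply/eqP; apply: contraT => nvw.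
have [oT ot tvo vo _] := oppositeP tT vt.
have [qT qt twq wq _] := oppositeP tT wt.
have Finj := F_inj hS hS' FT FI.
have noq : opposite t v != opposite t w.
  apply: contraNneq vo => ->; apply: (subsetP twq).
  by rewrite !inE nvw.
have : #|F (opposite t w) :&: (F t :&: F (opposite t v))| < 2.
  apply: (three_triangles hS'); rewrite ?FT //.
  - by apply: contraNneq ot => /Finj <-.
  - by apply: contraNneq qt => /Finj ->.
  - by apply: contraNneq noq => /Finj ->.
have -> : F t :&: F (opposite t v) = F t :&: F (opposite t w).
  apply/setP => i; move/setP/(_ i): E; rewrite !inE.
  by case: (i \in F t); rewrite ?andbF //= !andbT => /negb_inj.
by rewrite setICA setIid FI // card_opposite.
Qed.

(** Only a disagreement at one end [v] of the common edge is asked for; that the two ends are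
    exchanged is derived in [flip_search]. *)
Definition flip_at (t s : {set V}) (v : V) : bool :=
  [&& t \in T, s \in T, v \in t, v \in s, #|t :&: s| == 2 &
      transfer t v != transfer s v].

(** Without flips the transfer of [v] is constant around its link, and this constant defines
    [g v]. *)
Lemma induced_of_no_flip :
  (forall t s v, ~~ flip_at t s v) ->
  exists g : V -> V', forall t, t \in T -> g @: t = F t.
Proof.
move=> nf.
have [g gP] : exists g : V -> V', forall v, forall t, t \in T -> v \in t ->
    transfer t v = [set g v].
  apply: (@fin_all_exists V (fun=> V') (fun v w => forall t, t \in T -> v \in t ->
    transfer t v = [set w])) => v.
  have [t0 t0T vt0] := vertex_in_triangle v hS.
  have /eqP/cards1P[w wE] := card_transfer t0T vt0.
  exists w => t tT vt; apply/eqP; move: t tT vt.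
  apply: (link_connected hS _ t0T vt0); last by rewrite wE.
  move=> t r tT rT vt vr tr /eqP <-.
  by have := nf t r v; rewrite /flip_at tT rT vt vr tr /= negbK eq_sym.
(* Transfers at [t] lie in [F t] and are distinct, so [g] maps [t] onto all three vertices of
   [F t]. *)
exists g => t tT; apply/eqP; rewrite eqEcard (hS'.1 _ (FT tT)) card_in_imset.
  rewrite (hS.1 _ tT) andbT; apply/subsetP => _ /imsetP[v vt ->].
  by apply: (subsetP (transfer_sub t v)); rewrite gP // set11.
by move=> v w vt wt E; apply: (transfer_inj tT) => //; rewrite !gP // E.
Qed.

Lemma set3_card (W : finType) (A : {set W}) a b c :
  #|A| = 3 -> a \in A -> b \in A -> c \in A -> a != b -> a != c -> b != c ->
  A = [set a; b; c].
Proof.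
move=> cA aA bA cA' ab ac bc; apply/eqP; rewrite eq_sym eqEcard cA.
rewrite !subUset !sub1set aA bA cA' /= -setUA cardsU1 !inE cards2.
by rewrite (negbTE ab) (negbTE ac) bc.
Qed.

(** The disagreement at [v] forces the transfers of both ends of the common edge to be swapped. This
    fixes edges of the images of two further neighbours, from which the search starts. *)
Lemma flip_search t s v : flip_at t s v ->
  exists2 st, st \in leaves & exists x y, realizes T F st x y.
Proof.
case/and5P => tT sT vt vs /andP[/eqP ts flip].
have nts : t != s by apply: contra_eqN ts => /eqP ->; rewrite setIid hS.1.
have nst : s != t by rewrite eq_sym.
have st2 : #|s :&: t| = 2 by rewrite setIC.
have vI : v \in t :&: s by rewrite inE vt.
have [w wE] : exists w, (t :&: s) :\ v = [set w].
  by apply/cards1P; have := ts; rewrite (cardsD1 v) vI add1n => -[->].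
have [a aE] : exists a, t :\: s = [set a].
  by apply/cards1P; rewrite cardsD hS.1 // ts.
have [b bE] : exists b, s :\: t = [set b].
  by apply/cards1P; rewrite cardsD hS.1 // st2.
have := set11 w; rewrite -wE !inE => /and3P[nwv wt ws].
have := set11 a; rewrite -aE !inE => /andP[nas at_].
have := set11 b; rewrite -bE !inE => /andP[nbt bs].
have nav : a != v by apply: contraNneq nas => ->.
have naw : a != w by apply: contraNneq nas => ->.
have nbv : b != v by apply: contraNneq nbt => ->.
have nbw : b != w by apply: contraNneq nbt => ->.
have nba : b != a by apply: contraNneq nbt => ->.
have tE : t = [set a; v; w] by apply: set3_card; rewrite ?hS.1 // eq_sym.
have sE : s = [set v; w; b] by apply: set3_card; rewrite ?hS.1 // eq_sym.
have oa : opposite t a = s.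
  have [_ _ _ _ u] := oppositeP tT at_; apply/esym/u => //.
  apply/subsetP => i; rewrite tE sE !inE.
  by case/andP => /negbTE -> /= /orP[] ->; rewrite ?orbT.
have ob : opposite s b = t.
  have [_ _ _ _ u] := oppositeP sT bs; apply/esym/u => //.
  apply/subsetP => i; rewrite tE sE !inE.
  by case/andP => /negbTE ->; rewrite orbF => /orP[] ->; rewrite ?orbT.
have single r i : r \in T -> i \in r -> exists j, transfer r i = [set j].
  by move=> rT ir; apply/cards1P; rewrite card_transfer.
have diff r i j i' j' : r \in T -> i \in r -> j \in r -> i != j ->
    transfer r i = [set i'] -> transfer r j = [set j'] -> i' != j'.
  move=> rT ir jr nij iE jE; apply: contraNneq nij => E.
  by apply/eqP/(transfer_inj rT) => //; rewrite iE jE E.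
have mem r i i' : transfer r i = [set i'] ->
    (i' \in F r) /\ (i' \notin F (opposite r i)).
  by move=> iE; have := set11 i'; rewrite -iE inE => /andP[].
have only r i i' j : transfer r i = [set i'] -> j \in F r -> j != i' ->
    j \in F (opposite r i).
  by move=> iE jr ji; apply: contraNT ji => jo; rewrite -in_set1 -iE inE jo.
have [a' aE'] := single _ _ tT at_; have [b' bE'] := single _ _ sT bs.
have [v' vE'] := single _ _ tT vt; have [w' wE'] := single _ _ tT wt.
have [p pE] := single _ _ sT vs; have [q qE] := single _ _ sT ws.
have [a't a's] := mem _ _ _ aE'; rewrite oa in a's.
have [b's b't] := mem _ _ _ bE'; rewrite ob in b't.
have [v't _] := mem _ _ _ vE'; have [w't w'A] := mem _ _ _ wE'.
have [ps _] := mem _ _ _ pE; have [qs q'C] := mem _ _ _ qE.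
have nav' := diff _ _ _ _ _ tT at_ vt nav aE' vE'.
have naw' := diff _ _ _ _ _ tT at_ wt naw aE' wE'.
have nwv' := diff _ _ _ _ _ tT wt vt nwv wE' vE'.
have nbp := diff _ _ _ _ _ sT bs vs nbv bE' pE.
have nbq := diff _ _ _ _ _ sT bs ws nbw bE' qE.
have nqp := diff _ _ _ _ _ sT ws vs nwv qE pE.
(* Since [a'] is the one vertex of [F t] outside [F s], the images share exactly the edge of [v']
   and [w']. *)
have v's : v' \in F s by rewrite -oa; apply: only aE' v't _; rewrite eq_sym.
have w's : w' \in F s by rewrite -oa; apply: only aE' w't _; rewrite eq_sym.
have nbv' : b' != v' by apply: contraNneq b't => ->.
have nbw' : b' != w' by apply: contraNneq b't => ->.
have nba' : b' != a' by apply: contraNneq b't => ->.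
have FtE : F t = [set a'; v'; w'].
  by apply: set3_card; rewrite ?(hS'.1 _ (FT tT)) // eq_sym.
have FsE : F s = [set v'; w'; b'].
  by apply: set3_card; rewrite ?(hS'.1 _ (FT sT)) // eq_sym.
(* The transfer [p] of [v] at [s] lies in [F s] and differs from [b'] and, by the flip, from [v'];
   so it is [w'], and then [q] is [v']. *)
have npv' : p != v'.
  by apply: contraNneq flip => pv; rewrite vE' pE pv.
have pw : p = w'.
  by move: ps; rewrite FsE !inE (negbTE npv') [p == b']eq_sym (negbTE nbp) orbF => /eqP.
have qv : q = v'.
  move: qs; rewrite FsE !inE -pw (negbTE nqp) [q == b']eq_sym (negbTE nbq) !orbF.
  by move/eqP.
rewrite {}qv in qE q'C; clear p q pE ps qs nbp nbq nqp npv' pw.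
(* [A] lies over the edge of [a] and [v] (labels 01), [C] over that of [v] and [b] (labels 13). The
   transfers of [w] at [t] and [s] put [a'], [v'] in [F A] and [w'], [b'] in [F C]. *)
have [AT At Aw wA _] := oppositeP tT wt; have [CT Cs Cw wC _] := oppositeP sT ws.
set A := opposite t w in AT At Aw wA w'A; set C := opposite s w in CT Cs Cw wC q'C.
have a'A : a' \in F A by apply: only wE' a't naw'.
have v'A : v' \in F A by apply: only wE' v't _; rewrite eq_sym.
have w'C : w' \in F C by apply: only qE w's nwv'.
have b'C : b' \in F C by apply: only qE b's nbv'.
pose x k := nth v [:: a; v; w; b] k; pose y k := nth v' [:: a'; v'; w'; b'] k.
have xI : {in gtn 4 &, injective x}.
  move=> i j i4 j4 /eqP; rewrite nth_uniq //= ?inE; first by move/eqP.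
  by rewrite !negb_or nav naw (eq_sym a) nba (eq_sym v) nwv (eq_sym v) nbv
     (eq_sym w) nbw.
have yI : {in gtn 4 &, injective y}.
  move=> i j i4 j4 /eqP; rewrite nth_uniq //= ?inE; first by move/eqP.
  by rewrite !negb_or nav' naw' (eq_sym a') nba' (eq_sym v') nwv' (eq_sym v')
     nbv' (eq_sym w') nbw'.
have xt : im x [:: 0; 1; 2] = t by rewrite im3 tE.
have xs : im x [:: 1; 2; 3] = s by rewrite im3 sE.
have rs : realizes T F start x y.
  split=> // p; rewrite !inE => /orP[]/eqP->; rewrite /= ?xt ?xs; split=> //;
  by rewrite im3 ?FtE ?FsE.
have [st1 [x1 [y1 [st1e rs1 xx yy [c [c' [cA st1E]]]]]]] :
    exists st' x' y', [/\ st' \in extensions start [:: 0; 1] [:: 0; 1],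
    realizes T F st' x' y',
    {in gtn (nlabels1 start), x' =1 x}, {in gtn (nlabels2 start), y' =1 y} &
    exists c c', im x' c = A /\ pairs st' = (c, c') :: pairs start].
  apply: (extensions_sound hS hS' FT FI rs AT) => //.
  - move=> p; rewrite !inE => /orP[]/eqP->; rewrite /= ?xt ?xs 1?eq_sym //.
    by apply: contraNneq w'A => ->.
  - rewrite im_sub /= !(subsetP Aw) ?inE ?nav ?naw ?at_ ?vt //.
    by rewrite eq_sym nwv.
  - by rewrite im_sub /= a'A v'A.
have x1t : im x1 [:: 0; 1; 2] = t.
  by rewrite -xt; apply: eq_in_im => i i3; apply: xx; move: i i3; do 4!case=> //.
have x1s : im x1 [:: 1; 2; 3] = s.
  by rewrite -xs; apply: eq_in_im => i i3; apply: xx; move: i i3; do 4!case=> //.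
have [_ _ /(_ ([:: 1; 2; 3], [:: 1; 2; 3]))] := rs1.
rewrite st1E !inE eqxx !orbT => /(_ isT)[/and3P[_ _ n1] /and3P[_ _ n2] _ _].
have [st [x2 [y2 [ste rs2 _ _ _]]]] :
    exists st' x' y', [/\ st' \in extensions st1 [:: 1; 3] [:: 2; 3],
    realizes T F st' x' y',
    {in gtn (nlabels1 st1), x' =1 x1}, {in gtn (nlabels2 st1), y' =1 y1} &
    exists c c', im x' c = C /\ pairs st' = (c, c') :: pairs st1].
  apply: (extensions_sound hS hS' FT FI rs1 CT) => //.
  (* [C] differs from [A] and [t] because [v'] lies in the images of these two but not in [F C]. *)
  - move=> p; rewrite st1E !inE.
    case/or3P=> /eqP->; rewrite /= ?x1t ?x1s ?cA; last by rewrite eq_sym.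
      by apply: contraNneq q'C => <-.
    by apply: contraNneq q'C => <-.
  - by move: n1 => /= /and4P[-> _ -> _].
  - rewrite im_sub /= !xx // !(subsetP Cw) // !inE /= ?bs ?vs ?nbw //.
    by rewrite eq_sym nwv.
  - by move: n2 => /= /and4P[_ -> -> _].
  - by rewrite im_sub /= !yy // w'C b'C.
have [st3 st3s rs3] := search_sound hS hS' FT FI 12 rs2.
exists st3 => //; apply/flatten_mapP; exists st => //.
by apply/flatten_mapP; exists st1.
Qed.

End Flip.

(** * Identifying the leaves and conclusion *)

Definition half_icosahedron_relabelling : nat -> nat :=
  nth 0 [:: 0; 1; 3; 4; 5; 2].

(** The flipped edge 12 goes to the half-cube edge from $a_0$ to $a_4$, and labels 0 and 3 to the
    face centres $a_1$ and $a_3$ beside it. *)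
Definition triangulated_half_cube_relabelling : nat -> nat :=
  nth 0 [:: 1; 0; 4; 3; 6; 2; 5].

Definition is_model (pi : nat -> nat) (M : seq (seq nat)) (st : state) : bool :=
  relabels pi (unzip1 (pairs st)) M && relabels pi (unzip2 (pairs st)) M.

(** The whole search is evaluated. The absence of open edges shows that no branch was cut off by the
    fuel. *)
Lemma leaves_are_models :
  all (fun st => [&& 0 < size (pairs st), nilp (open_edges (pairs st)) &
    is_model half_icosahedron_relabelling half_icosahedron_labels st ||
    is_model triangulated_half_cube_relabelling triangulated_half_cube_labels st])
  leaves.
Proof. by vm_compute. Qed.

Theorem theorem2 (V V' : finType) (T : {set {set V}}) (T' : {set {set V'}})
    (hS : triangulated_closed_surface T) (cS : connected_complex T)
    (hS' : triangulated_closed_surface T') (cS' : connected_complex T')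
    (f : {t : {set V} | t \in T} -> {t : {set V'} | t \in T'})
    (f_bij : bijective f)
    (f_inter : forall t1 t2 : {t : {set V} | t \in T},
      #|val t1 :&: val t2| = #|val (f t1) :&: val (f t2)|)
    (f_not_induced : ~ exists g : V -> V',
      simplicial_map T T' g /\
      (forall t : {t : {set V} | t \in T}, g @: val t = val (f t))) :
  (isomorphic T half_icosahedron /\ isomorphic T' half_icosahedron) \/
  (isomorphic T triangulated_half_cube /\ isomorphic T' triangulated_half_cube).
Proof.
(* [F] extends [f] to all vertex sets; the value [set0] is taken only outside [T]. *)
pose F t := if insub t is Some u then val (f u) else set0.
have Fval u : F (val u) = val (f u) by rewrite /F valK.
have FE t (tT : t \in T) : F t = val (f (Sub t tT)) by rewrite -Fval SubK.
have FT t : t \in T -> F t \in T' by move=> tT; rewrite (FE _ tT) (valP (f _)).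
have FI t r : t \in T -> r \in T -> #|F t :&: F r| = #|t :&: r|.
  by move=> tT rT; rewrite (FE _ tT) (FE _ rT) -f_inter !SubK.
have Fsurj t' : t' \in T' -> exists2 t, t \in T & F t = t'.
  case: f_bij => h _ fK t'T; exists (val (h (Sub t' t'T))); first exact: valP.
  by rewrite Fval fK SubK.
have [[[t s] v] flip|noflip] :=
    pickP (fun z : {set V} * {set V} * V => flip_at T F z.1.1 z.1.2 z.2); last first.
  have [g gF] : exists g : V -> V', forall t, t \in T -> g @: t = F t.
    apply: (induced_of_no_flip hS hS' FT FI) => t s v.
    by have /= -> := noflip (t, s, v).
  case: f_not_induced; exists g; split => [A|t]; last first.
    by rewrite gF ?Fval //; apply: valP.
  (* A map inducing [f] on triangles is simplicial, because each simplex lies in a triangle. *)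
  case/andP => A0 /existsP[t /andP[tT At]]; rewrite /is_simplex imset_eq0 A0 /=.
  by apply/existsP; exists (F t); rewrite FT // -gF // imsetS.
have [st st_leaf [x [y rst]]] := flip_search hS hS' FT FI flip.
have /and3P[st0 /nilP cl model] := allP leaves_are_models _ st_leaf.
have [pT pT'] := closed_presents hS hS' FT cS Fsurj rst st0 cl.
case/orP: model => /andP[m m']; [left | right];
  split; (apply: presents_isomorphic;
    [eassumption | apply: presents_relabel; last eassumption]);
  by [apply: half_icosahedron_presents | apply: triangulated_half_cube_presents].
Qed.
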